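(* Let $|q|<1$, let $k\geq 1$ be an integer, let $a_1,\dots,a_{k-1}$, $b_1,\dots,b_{k-1}$, $c_1,\dots,c_{k-1}$ and $a$ be complex numbers, and let $\{g(j)\}_{j=-\infty}^{\infty}$ be a sequence of complex numbers such that both series below converge. Let the sum on the left be over all integer $(k+1)$-tuples $\vec{m}=(m_1,\dots,m_{k+1})$ with $m_1\geq m_2\geq\dots\geq m_k\geq 0$ and $m_k\geq m_{k+1}>-\infty$ (so $m_{k+1}$ ranges over all integers $\le m_k$). Then \[ \sum_{\vec{m}}\prod_{j=1}^{k-1}\frac{(a_j;q)_{m_j}(c_j/b_j;q)_{m_{j+1}}(b_j;q)_{m_j-m_{j+1}}}{(c_j;q)_{m_j}(a_j;q)_{m_{j+1}}(q;q)_{m_j-m_{j+1}}}\left(\frac{c_j}{a_jb_j}\right)^{m_j-m_{j+1}} \times\frac{(a;q)_{m_k}(q/a;q)_{m_{k+1}}(a;q)_{m_k-m_{k+1}}}{(q;q)_{m_k}(a;q)_{m_{k+1}}(q;q)_{m_k-m_{k+1}}}\left(\frac{q}{a^2}\right)^{m_k-m_{k+1}} g(m_{k+1}) \] \[ =\frac{(q/a,q/a;q)_{\infty}}{(q,q/a^2;q)_{\infty}}\prod_{j=1}^{k-1}\frac{(c_j/a_j,c_j/b_j;q)_{\infty}}{(c_j,c_j/a_jb_j;q)_{\infty}}\sum_{j=-\infty}^{\infty}g(j). \]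
   Context: Notation: $(x;q)_n=(1-x)(1-xq)\cdots(1-xq^{n-1})$ for integers $n\ge0$, extended to negative integers by $(x;q)_{-n}=1/(xq^{-n};q)_n$; $(x;q)_\infty=\prod_{i\ge0}(1-xq^i)$; $(x_1,\dots,x_r;q)_n=\prod_i(x_i;q)_n$. Parameters are assumed such that no denominator vanishes. *)

(* Defs.v *)
From HB Require Import structures.
From mathcomp Require Import all_boot all_order all_algebra.
From mathcomp Require Import complex.
From mathcomp Require Import all_classical all_reals all_analysis.
From mathcomp Require Export summability.

Set Implicit Arguments.
Unset Strict Implicit.
Unset Printing Implicit Defensive.

Import Order.TTheory GRing.Theory Num.Theory.
Import numFieldNormedType.Exports.

Local Open Scope classical_set_scope.
Local Open Scope ring_scope.

(* R[i] has no topology declared on it directly; packing it as a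
   numClosedFieldType gives it the one induced by the modulus. *)
Definition cplx (R : realType) : numClosedFieldType := R[i]%C.

Section QPochhammer.
Variable R : realType.
Implicit Types x q : cplx R.

Definition qpoch_nat x q (n : nat) : cplx R := \prod_(i < n) (1 - x * q ^+ i).

Definition qpoch x q (n : int) : cplx R :=
  match n with
  | Posz n' => qpoch_nat x q n'
  | Negz n' => (qpoch_nat (x * q ^- n'.+1) q n'.+1)^-1
  end.

(* Junk value if the partial products diverge; they converge when |q| < 1. *)
Definition qpoch_inf x q : cplx R := limn (qpoch_nat x q).

(* (x;q)_n has a nonzero denominator for every negative n. *)
Definition qpoch_neg_defined x q : Prop :=
  forall n : nat, qpoch_nat (x * q ^- n) q n != 0.

End QPochhammer.

(* Unordered convergence: the net of sums over finite subsets of I, directed by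
   inclusion, has a limit; the limit is [summability.sum x]. *)
Definition unordered_cvg (R : realType) (I : choiceType) (x : I -> cplx R) :
  Prop := cvg (partial_sum x @ totally).

(* The two halves of the series are required to converge separately. *)
Definition bilateral_cvg (R : realType) (g : int -> cplx R) : Prop :=
  cvgn (series (fun n : nat => g (Posz n))) /\
  cvgn (series (fun n : nat => g (Negz n))).

Definition bilateral_sum (R : realType) (g : int -> cplx R) : cplx R :=
  limn (series (fun n : nat => g (Posz n))) +
  limn (series (fun n : nat => g (Negz n))).

(* Here and below the entries are numbered from 0: m`_0, ..., m`_k stand for
   m_1, ..., m_{k+1}; likewise for the parameters a_j, b_j, c_j. *)
Definition admissible (k : nat) (m : (k.+1).-tuple int) : bool :=
  [forall j : 'I_k, m`_j.+1 <= m`_j] && (0 <= m`_k.-1).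

Definition multi_index (k : nat) := {m : (k.+1).-tuple int | admissible m}.

HB.instance Definition _ (k : nat) := Choice.on (multi_index k).

Definition multi_term (R : realType) (k : nat) (q : cplx R)
    (a_ b_ c_ : 'I_k.-1 -> cplx R) (a : cplx R) (g : int -> cplx R)
    (mi : multi_index k) : cplx R :=
  let m := val mi in
  let M := m`_k.-1 in
  let N := m`_k in
  (\prod_(j < k.-1)
     ((qpoch (a_ j) q m`_j * qpoch (c_ j / b_ j) q m`_j.+1
         * qpoch (b_ j) q (m`_j - m`_j.+1))
      / (qpoch (c_ j) q m`_j * qpoch (a_ j) q m`_j.+1
         * qpoch q q (m`_j - m`_j.+1))
      * (c_ j / (a_ j * b_ j)) ^ (m`_j - m`_j.+1)))
  * ((qpoch a q M * qpoch (q / a) q N * qpoch a q (M - N))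
     / (qpoch q q M * qpoch a q N * qpoch q q (M - N))
     * (q / a ^+ 2) ^ (M - N))
  * g N.

(* Main.v *)
(* Every factor of the summand, the last one included, has the shape
   F(M, N) = (a)_M (c/b)_N (b)_{M-N} / ((c)_M (a)_N (q)_{M-N}) (c/ab)^{M-N},
   with b = a and c = q for the last. By the q-Gauss sum, the sum of F(M, N) over
   M does not depend on N, so summing over m_1, m_2, ... in turn strips the
   factors one by one. The hypothesis |c/(ab)| < 1 of the q-Gauss sum is replaced
   by "the terms tend to 0", which unordered convergence of the multiple series
   gives for each inner sum; thus no absolute convergence is needed. If one of the
   constants produced vanishes, both sides are 0.

   The q-Gauss sum itself comes from iterating its contiguous relation C -> Cq. *)

Require Import Defs.
From mathcomp Require Import all_boot all_order all_algebra.
From mathcomp Require Import all_classical all_reals all_analysis.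
From mathcomp Require Import finmap complex ring lra zify.
Set Implicit Arguments.
Unset Strict Implicit.
Unset Printing Implicit Defensive.
Import Order.TTheory GRing.Theory Num.Theory.
Import numFieldNormedType.Exports.
Local Open Scope ring_scope.

(** The modulus as an element of [R]: [|z|] itself has type [cplx R], whose order is only partial,
    so all estimates are made in [R]. *)
Definition nm (R : realType) (z : cplx R) : R := ComplexField.Normc.normc z.

(** * Real-valued modulus and convergence in the complex numbers *)

Section Modulus.
Variable R : realType.
Implicit Types (x y z : cplx R) (u : nat -> cplx R).

Lemma normE z : `|z| = ((nm z)%:C)%C.
Proof. by []. Qed.

Lemma nm_ge0 z : 0 <= nm z.
Proof. by case: z => a b; rewrite /nm /= sqrtr_ge0. Qed.

Lemma nm0 : nm (0 : cplx R) = 0.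
Proof. exact: ComplexField.Normc.normc0. Qed.

Lemma nm1 : nm (1 : cplx R) = 1.
Proof. exact: ComplexField.Normc.normc1. Qed.

Lemma nmM x y : nm (x * y) = nm x * nm y.
Proof. exact: ComplexField.Normc.normcM. Qed.

Lemma nmV x : nm x^-1 = (nm x)^-1.
Proof. exact: ComplexField.Normc.normcV. Qed.

Lemma nmX x n : nm (x ^+ n) = nm x ^+ n.
Proof. by elim: n => [|n IH]; rewrite ?expr0 ?nm1 // !exprS nmM IH. Qed.

Lemma nmD x y : nm (x + y) <= nm x + nm y.
Proof. by have := ler_normD x y; rewrite !normE -rmorphD lecR. Qed.

Lemma nmN x : nm (- x) = nm x.
Proof. by have := normrN x; rewrite !normE => -[]. Qed.

Lemma nmB x y : nm (x - y) <= nm x + nm y.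
Proof. by rewrite -(nmN y); exact: nmD. Qed.

Lemma nmC x y : nm (x - y) = nm (y - x).
Proof. by rewrite -nmN opprB. Qed.

Lemma nm_triangle y x z : nm (x - z) <= nm (x - y) + nm (y - z).
Proof. by rewrite -[x - z](subrKA y); exact: nmD. Qed.

Lemma nm_eq0 x : (nm x == 0) = (x == 0).
Proof. by rewrite -[x == 0]normr_eq0 normE; rewrite -(inj_eq (@complexI R)). Qed.

Lemma nm_gt0 x : (0 < nm x) = (x != 0).
Proof. by rewrite lt_def nm_ge0 andbT nm_eq0. Qed.

Lemma nm_sum (I : Type) (r : seq I) (P : pred I) (F : I -> cplx R) :
  nm (\sum_(i <- r | P i) F i) <= \sum_(i <- r | P i) nm (F i).
Proof.
elim/big_ind2: _ => [|x1 x2 y1 y2 h1 h2|//]; first by rewrite nm0.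
exact: le_trans (nmD _ _) (lerD h1 h2).
Qed.

Lemma nm_lt1 z : `|z| < 1 -> nm z < 1.
Proof. by rewrite normE (_ : 1 = (1 : R)%:C%C) // ltcR. Qed.

(** A positive element of [cplx R] is real, so the radii may be taken in [R]. *)
Lemma cvg_nmP (T : Type) (F : set_system T) {FF : Filter F} (f : T -> cplx R)
    (l : cplx R) :
  (f @ F --> l)%classic <->
  (forall e : R, 0 < e -> (\forall t \near F, nm (f t - l) < e)%classic).
Proof.
split=> [/cvgrPdist_lt h e e0|h].
  have /h : (0 : cplx R) < e%:C%C by rewrite ltcR.
  by apply: filterS => t; rewrite normE ltcR nmC.
apply/cvgrPdist_lt => e e0.
have eE : e = ((complex.Re e)%:C)%C by rewrite RRe_real // ger0_real // ltW.
have /h : 0 < complex.Re e by rewrite -ltcR -eE.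
by apply: filterS => t; rewrite eE normE ltcR nmC.
Qed.

Lemma cvgn_nmP u l : (u @ \oo --> l)%classic <->
  forall e : R, 0 < e -> exists N, forall n, (N <= n)%N -> nm (u n - l) < e.
Proof.
split=> [/cvg_nmP h e e0|h].
  by have [N _ hN] := h e e0; exists N => n Nn; apply: hN.
by apply/cvg_nmP => e /h [N hN]; exists N => // n; exact: hN.
Qed.

Lemma ge_nm_Re z : `|complex.Re z| <= nm z.
Proof. by rewrite -lecR; exact: normc_ge_Re. Qed.

Lemma ge_nm_Im z : `|complex.Im z| <= nm z.
Proof.
case: z => a b; rewrite /nm /= -sqrtr_sqr ler_sqrt ?lerDr ?sqr_ge0 //.
by rewrite addr_ge0 ?sqr_ge0.
Qed.

Lemma le_nm_ReIm z : nm z <= `|complex.Re z| + `|complex.Im z|.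
Proof.
case: z => a b; rewrite /nm /=.
rewrite -[leRHS]ger0_norm ?addr_ge0 // -sqrtr_sqr ler_sqrt ?sqr_ge0 //.
rewrite sqrrD !real_normK ?num_real // lerD2r lerDl.
by rewrite mulrn_wge0 // mulr_ge0.
Qed.

(** Completeness is inherited from [R]: real and imaginary parts are bounded by [nm], hence
    Cauchy. *)
Lemma cplx_cauchy_cvg u :
  (forall e : R, 0 < e -> exists N, forall n, (N <= n)%N -> nm (u n - u N) < e) ->
  cvgn u.
Proof.
move=> hu.
have real_cvg (p : cplx R -> R) : (forall x y, p (x - y) = p x - p y) ->
    (forall x, `|p x| <= nm x) ->
    exists a, forall e, 0 < e -> exists N, forall n, (N <= n)%N -> `|a - p (u n)| < e.
  move=> pB hp.
  have /cvg_ex[a ha] : cvgn (fun n => p (u n) : R).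
    apply: cauchy_cvg; apply: cauchy_exP => e e0.
    have [N hN] := hu e e0; exists (p (u N)); exists N => // n /= Nn.
    rewrite /ball /= -pB; apply: le_lt_trans (hp _) _.
    by rewrite nmC; exact: hN.
  exists a => e e0; have [N _ hN] := (cvgrPdist_lt _ _).1 ha e e0.
  by exists N => n; exact: hN.
have [|a ha] := real_cvg _ _ (@ge_nm_Re); first by move=> [? ?] [? ?].
have [|b hb] := real_cvg _ _ (@ge_nm_Im); first by move=> [? ?] [? ?].
apply: (cvgP (a +i* b : cplx R)%C); apply/cvgn_nmP => e e0.
have e20 : 0 < e / 2 by rewrite divr_gt0.
have [N1 h1] := ha _ e20; have [N2 h2] := hb _ e20.
exists (maxn N1 N2) => n; rewrite geq_max => /andP[/h1 /= + /h2 /= +].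
rewrite distrC (distrC b) => k1 k2; apply: le_lt_trans (le_nm_ReIm _) _.
by rewrite [e]splitr; case: (u n) k1 k2 => x y /= k1 k2; exact: ltrD.
Qed.

Lemma cvgn_uniq u (l l' : cplx R) :
  (u @ \oo --> l)%classic -> (u @ \oo --> l')%classic -> l = l'.
Proof. by move=> h h'; rewrite -(cvg_lim _ h) // -(cvg_lim _ h'). Qed.

End Modulus.

Lemma nneg_seq_bounded (R : realType) (v : nat -> R) (N : nat) (B : R) :
  (forall n, 0 <= v n) -> (forall n, v (N + n)%N <= B) ->
  exists2 K, 0 < K & forall n, v n <= K.
Proof.
move=> v0 hv; have B0 : 0 <= B := le_trans (v0 _) (hv 0%N).
have s0 : 0 <= \sum_(i < N) v i by apply: sumr_ge0.
exists (\sum_(i < N) v i + B + 1); first by lra.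
move=> n; have [nN|Nn] := ltnP n N; last first.
  by have := hv (n - N)%N; rewrite subnKC // => ?; lra.
have : v n <= \sum_(i < N) v i.
  by rewrite (bigD1 (Ordinal nN)) //= lerDl sumr_ge0.
lra.
Qed.

Lemma exprn_small (R : realType) (r x d : R) :
  0 <= r < 1 -> 0 <= x -> 0 < d -> exists N, x * r ^+ N < d.
Proof.
move=> /andP[r0 r1] x0 d0.
have rr : `|r| < 1 by rewrite ger0_norm.
have dx : 0 < d / (x + 1) by rewrite divr_gt0 // ltr_wpDl.
have [N _ hN] := (cvgrPdist_lt _ _).1 (cvg_expr rr) _ dx.
exists N; have := hN N (leqnn _); rewrite /= sub0r normrN ger0_norm ?exprn_ge0 //.
rewrite ltr_pdivlMr ?ltr_wpDl // => h; apply: le_lt_trans h.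
by rewrite mulrC ler_wpM2l ?exprn_ge0 ?lerDl.
Qed.

(** * Convergence and non-vanishing of infinite q-products *)

Section InfiniteProduct.
Variables (R : realType) (q : cplx R).
Hypothesis q1 : nm q < 1.
Implicit Types (x : cplx R).

Let q1B : 0 < 1 - nm q. Proof. by rewrite subr_gt0. Qed.
Let q01 : 0 <= nm q < 1. Proof. by rewrite nm_ge0. Qed.

Lemma qpoch_nat0 x : qpoch_nat x q 0 = 1.
Proof. by rewrite /qpoch_nat big_ord0. Qed.

Lemma qpoch_natS x n : qpoch_nat x q n.+1 = qpoch_nat x q n * (1 - x * q ^+ n).
Proof. by rewrite /qpoch_nat big_ord_recr. Qed.

Lemma qpoch_natD x m n :
  qpoch_nat x q (m + n) = qpoch_nat x q m * qpoch_nat (x * q ^+ m) q n.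
Proof.
elim: n => [|n IH]; first by rewrite addn0 qpoch_nat0 mulr1.
by rewrite addnS !qpoch_natS IH exprD !mulrA.
Qed.

Lemma qpoch_natSl x n :
  qpoch_nat x q n.+1 = (1 - x) * qpoch_nat (x * q) q n.
Proof. by rewrite -add1n qpoch_natD qpoch_natS qpoch_nat0 mul1r mulr1. Qed.

(** [nm x / (1 - nm q)] is the geometric series dominating the [|x q^i|]. The threshold [4^-1] keeps
    [|(x;q)_n| <= 2] during the induction, so each new factor changes the product by at most
    [2 |x| |q|^n]. *)
Lemma qpoch_nat_near1 x n : nm x / (1 - nm q) <= 4^-1 ->
  nm (qpoch_nat x q n - 1) <= 2 * (nm x / (1 - nm q)).
Proof.
move=> hx; set y := nm x / _.
have y0 : 0 <= y by rewrite divr_ge0 ?nm_ge0 // ltW.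
(* The induction needs the partial geometric sum as its bound, not the full one. *)
suff : nm (qpoch_nat x q n - 1) <= 2 * (y * (1 - nm q ^+ n)).
  move=> /le_trans; apply; rewrite ler_wpM2l // -[leRHS]mulr1.
  by rewrite ler_wpM2l // gerBl exprn_ge0 ?nm_ge0.
elim: n => [|n IH]; first by rewrite qpoch_nat0 subrr nm0 expr0 subrr !mulr0.
have -> : qpoch_nat x q n.+1 - 1 = (qpoch_nat x q n - 1) +
    - (x * q ^+ n) * (1 + (qpoch_nat x q n - 1)) by rewrite qpoch_natS; ring.
apply: le_trans (nmD _ _) _; rewrite nmM nmN nmM nmX.
have xE : nm x = y * (1 - nm q) by rewrite /y divfK // gt_eqF.
have /le_trans/(_ (lerD (lexx _) IH)) := nmD 1 (qpoch_nat x q n - 1); rewrite nm1.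
move: (nm (1 + _)) (nm (_ - 1)) IH => v w IH hv.
have rn0 : 0 <= nm q ^+ n by rewrite exprn_ge0 ?nm_ge0.
have rn1 : nm q ^+ n <= 1 by rewrite exprn_ile1 ?nm_ge0 ?ltW.
have v2 : v <= 2.
  have : y * (1 - nm q ^+ n) <= y * 1 by rewrite ler_wpM2l // gerBl.
  have y4 : y <= 4^-1 by [].
  by rewrite mulr1; move: (y * (1 - _)) hv => t *; lra.
have : nm x * nm q ^+ n * v <= nm x * nm q ^+ n * 2.
  by rewrite ler_wpM2l // mulr_ge0 ?nm_ge0.
move=> /(lerD IH) /le_trans; apply; rewrite xE exprS.
by rewrite le_eqVlt; apply/orP; left; apply/eqP; ring.
Qed.

Lemma qpoch_nat_tail x (d : R) : 0 < d -> exists N, forall m n, (N <= m)%N ->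
  nm (qpoch_nat (x * q ^+ m) q n - 1) < d.
Proof.
(* [4^-1] is what [qpoch_nat_near1] requires; [d / 3] brings its bound below [d]. *)
move=> d0; have e0 : 0 < Num.min (4^-1) (d / 3) by rewrite lt_min divr_gt0 // invr_gt0 ltr0n.
have [N hN] := exprn_small q01 (divr_ge0 (nm_ge0 x) (ltW q1B)) e0.
exists N => m n Nm; have h : nm (x * q ^+ m) / (1 - nm q) < Num.min (4^-1) (d / 3).
  apply: le_lt_trans hN; rewrite nmM nmX mulrAC ler_wpM2l //.
    by rewrite divr_ge0 ?nm_ge0 // ltW.
  by rewrite ler_wiXn2l ?nm_ge0 // ltW.
have [h1 h2] : nm (x * q ^+ m) / (1 - nm q) < 4^-1 /\
    nm (x * q ^+ m) / (1 - nm q) < d / 3 by move: h; rewrite lt_min => /andP.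
by apply: le_lt_trans (qpoch_nat_near1 n (ltW h1)) _; lra.
Qed.

Lemma qpoch_nat_bounded x : exists2 K, 0 < K & forall n, nm (qpoch_nat x q n) <= K.
Proof.
have [N hN] := @qpoch_nat_tail x 1 ltr01.
apply: (@nneg_seq_bounded _ (fun n => nm (qpoch_nat x q n)) N
  (nm (qpoch_nat x q N) * 2)) => n; first exact: nm_ge0.
rewrite qpoch_natD nmM ler_wpM2l ?nm_ge0 //.
have := hN N n (leqnn _); have := nmD (qpoch_nat (x * q ^+ N) q n - 1) 1.
by rewrite subrK nm1; lra.
Qed.

(** A tail product within [1/2] of 1 has modulus at least [1/2], so its inverse is at most 2. *)
Lemma qpoch_nat_inv_bounded x : (forall n, qpoch_nat x q n != 0) ->
  exists2 K, 0 < K & forall n, nm (qpoch_nat x q n)^-1 <= K.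
Proof.
move=> hx; have half_gt0 : 0 < 2^-1 :> R by rewrite invr_gt0.
have [N hN] := qpoch_nat_tail x half_gt0.
apply: (@nneg_seq_bounded _ (fun n => nm (qpoch_nat x q n)^-1) N
  (nm (qpoch_nat x q N)^-1 * 2)) => n; first exact: nm_ge0.
rewrite qpoch_natD invfM nmM ler_wpM2l ?nm_ge0 // nmV.
have := hN N n (leqnn _); rewrite nmC.
have := nmD (1 - qpoch_nat (x * q ^+ N) q n) (qpoch_nat (x * q ^+ N) q n).
rewrite subrK nm1 => h1 h2.
by rewrite invf_ple ?posrE; lra.
Qed.

Lemma cvg_qpoch_inf x : (qpoch_nat x q @ \oo --> qpoch_inf x q)%classic.
Proof.
apply: cplx_cauchy_cvg => e e0.
have [K K0 hK] := qpoch_nat_bounded x.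
have [N hN] := @qpoch_nat_tail x (e / K) (divr_gt0 e0 K0).
exists N => n Nn; rewrite -(subnKC Nn) qpoch_natD -[X in _ - X]mulr1 -mulrBr nmM.
have := hN N (n - N)%N (leqnn _); rewrite ltr_pdivlMr // mulrC; apply: le_lt_trans.
by rewrite ler_wpM2r ?nm_ge0.
Qed.

Lemma qpoch_inf_shift x n :
  qpoch_inf x q = qpoch_nat x q n * qpoch_inf (x * q ^+ n) q.
Proof.
apply: (@cvgn_uniq _ (fun m => qpoch_nat x q (m + n))).
  by rewrite cvg_shiftn; exact: cvg_qpoch_inf.
under eq_fun do rewrite addnC qpoch_natD.
by apply: cvgMr; exact: cvg_qpoch_inf.
Qed.

(** The inverses of the partial products are bounded, which keeps the limit away from 0. *)
Lemma qpoch_inf_neq0 x : (forall n, qpoch_nat x q n != 0) -> qpoch_inf x q != 0.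
Proof.
move=> hx; have [K K0 hK] := qpoch_nat_inv_bounded hx.
apply/eqP => x0; have /cvgn_nmP := @cvg_qpoch_inf x.
rewrite x0 => /(_ K^-1); rewrite invr_gt0 => /(_ K0)[N /(_ N (leqnn _))].
have := hK N; rewrite subr0 nmV => h1 h2.
by move: h1; rewrite invf_ple ?posrE ?nm_gt0 // leNgt h2.
Qed.

Lemma qpoch_nat_neq0 x n : qpoch_inf x q != 0 -> qpoch_nat x q n != 0.
Proof. by rewrite (qpoch_inf_shift x n) mulf_eq0 => /norP[]. Qed.

End InfiniteProduct.

(** * The q-Gauss sum *)

Section Gauss.
Variables (R : realType) (q : cplx R).
Hypothesis q1 : nm q < 1.
Implicit Types (A B z : cplx R).

Lemma qpoch_nat_qq_neq0 n : qpoch_nat q q n != 0.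
Proof.
apply/prodf_neq0 => i _; rewrite -exprS subr_eq0; apply/eqP => h.
have : nm q ^+ i.+1 < 1 by rewrite exprn_ilt1 ?nm_ge0.
by rewrite -nmX -h nm1 ltxx.
Qed.

(* The r-th term of 2phi1(A, B; C; q, z) at the Gauss point z = C/(AB). *)
Definition gauss_term A B z r : cplx R :=
  qpoch_nat A q r * qpoch_nat B q r / (qpoch_nat (z * A * B) q r * qpoch_nat q q r)
  * z ^+ r.

Lemma gauss_term0 A B z : gauss_term A B z 0 = 1.
Proof. by rewrite /gauss_term !qpoch_nat0 !mulr1 divr1. Qed.

(** Put [C = z * A * B]. Replacing [z] by [z * q] replaces [C] by [C * q], and
    [(1 - C) (Cq;q)_n = (C;q)_n (1 - C q^n)]. *)
Lemma gauss_term_shift A B z n : (forall n, qpoch_nat (z * A * B) q n != 0) ->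
  (1 - z * A * B * q ^+ n) * gauss_term A B (z * q) n =
  (1 - z * A * B) * q ^+ n * gauss_term A B z n.
Proof.
move=> hC; have := hC n.+1; rewrite qpoch_natS => h1.
have := qpoch_natSl q (z * A * B) n; rewrite qpoch_natS => h2.
have := qpoch_nat_qq_neq0 n; move: h1 h2 (hC 1%N).
rewrite qpoch_natSl qpoch_nat0 mulr1 /gauss_term.
rewrite (_ : z * q * A * B = z * A * B * q); last by ring.
rewrite exprMn; set C := z * A * B.
move: (qpoch_nat C q n) (qpoch_nat (C * q) q n) (qpoch_nat q q n) => u v w.
rewrite mulf_eq0 => /norP[u0 Cn0] h C0 w0.
have v0 : v != 0 by apply: contraTneq (mulf_neq0 u0 Cn0); rewrite h => ->; rewrite mulr0 eqxx.
have -> : u = (1 - C) * v / (1 - C * q ^+ n) by rewrite -h mulfK.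
by field; rewrite Cn0 v0 w0 C0.
Qed.

(* Gauss's contiguous relation C -> Cq, summed by telescoping. *)
Lemma gauss_sum_contiguous A B z n : (forall n, qpoch_nat (z * A * B) q n != 0) ->
  (1 - z * A * B) * (1 - z) * \sum_(i < n) gauss_term A B z i
  - (1 - z * A) * (1 - z * B) * \sum_(i < n) gauss_term A B (z * q) i =
  - ((1 - z * A * B) * (1 - q ^+ n) * gauss_term A B z n).
Proof.
move=> hC; elim: n => [|n IH].
  by rewrite !big_ord0 expr0 subrr !(mulr0, mul0r) subrr oppr0.
rewrite !big_ord_recr /= (mulrDr ((1 - z * A * B) * _)) (mulrDr ((1 - z * A) * _)).
rewrite opprD addrACA IH.
have Cn0 : 1 - z * A * B * q ^+ n != 0.
  by have := hC n.+1; rewrite qpoch_natS mulf_eq0 => /norP[].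
have Qn0 : 1 - q ^+ n.+1 != 0.
  by have := qpoch_nat_qq_neq0 n.+1; rewrite qpoch_natS mulf_eq0 -exprS => /norP[].
have tS : gauss_term A B z n.+1 * (1 - z * A * B * q ^+ n) * (1 - q ^+ n.+1) =
    (1 - A * q ^+ n) * (1 - B * q ^+ n) * z * gauss_term A B z n.
  rewrite /gauss_term !qpoch_natS !exprS in Qn0 *.
  have := hC n; have := qpoch_nat_qq_neq0 n.
  by move=> h1 h2; field; rewrite h1 h2 Cn0 Qn0.
(* Multiplied by [1 - C q^n], the contributions of [t'] and [s] become multiples of [t], and a
   polynomial identity remains. *)
apply: (mulfI Cn0); have := gauss_term_shift n hC; rewrite exprSr in Qn0 tS *.
move: tS; set C := z * A * B in Cn0 *.
move: (gauss_term A B z n) (gauss_term A B z n.+1) (gauss_term A B (z * q) n).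
move=> t t' s h1 h2.
transitivity ((1 - C * q ^+ n) * (- ((1 - C) * (1 - q ^+ n) * t) + (1 - C) * (1 - z) * t)
  - (1 - z * A) * (1 - z * B) * ((1 - C * q ^+ n) * s)); first by ring.
transitivity (- ((1 - C) * (t' * (1 - C * q ^+ n) * (1 - q ^+ n * q)))); last by ring.
by rewrite h1 h2 /C; ring.
Qed.

Lemma cvg_gauss_term_shift A B z : (forall n, qpoch_nat (z * A * B) q n != 0) ->
  (gauss_term A B z @ \oo --> (0 : cplx R))%classic ->
  (gauss_term A B (z * q) @ \oo --> (0 : cplx R))%classic.
Proof.
move=> hC /cvgn_nmP ht; apply/cvgn_nmP => e e0.
have [K K0 hK] := qpoch_nat_bounded q1 (z * A * B).
have [L L0 hL] := qpoch_nat_inv_bounded q1 hC.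
have M0 : 0 < K * L * (nm (1 - z * A * B) + 1).
  by rewrite !mulr_gt0 // ltr_wpDl ?nm_ge0.
have [N hN] := ht _ (divr_gt0 e0 M0); exists N => n /hN; rewrite !subr0.
rewrite ltr_pdivlMr // mulrC; apply: le_lt_trans.
have Cn0 : 1 - z * A * B * q ^+ n != 0.
  by have := hC n.+1; rewrite qpoch_natS mulf_eq0 => /norP[].
rewrite -[gauss_term _ _ (z * q) _](mulKf Cn0) gauss_term_shift // mulrA nmM.
rewrite ler_wpM2r ?nm_ge0 // nmM ler_pM ?nm_ge0 //; last first.
  rewrite nmM nmX -[leRHS]mulr1 ler_pM ?exprn_ge0 ?nm_ge0 ?lerDl //.
  by rewrite exprn_ile1 ?nm_ge0 ?ltW.
(* As a quotient of partial products this is bounded by [K * L], uniformly in [n]. *)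
have -> : (1 - z * A * B * q ^+ n)^-1 =
    qpoch_nat (z * A * B) q n * (qpoch_nat (z * A * B) q n.+1)^-1.
  by rewrite qpoch_natS invfM mulrA divff ?mul1r.
by rewrite nmM ler_pM ?nm_ge0.
Qed.

(** For nonzero [A], [B] one has [z * A = C / B] and [z * B = C / A]: these are the partial products
    of Gauss's value. *)
Definition gauss_ratio A B z n : cplx R :=
  qpoch_nat (z * A) q n * qpoch_nat (z * B) q n
  / (qpoch_nat (z * A * B) q n * qpoch_nat z q n).

(** Only a difference of partial sums is controlled, since neither sum is known to converge yet: the
    boundary terms of the [N] contiguous steps tend to 0 with [n]. *)
Lemma gauss_sum_iter A B z N : (forall n, qpoch_nat (z * A * B) q n != 0) ->
  (forall n, qpoch_nat z q n != 0) ->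
  (gauss_term A B z @ \oo --> (0 : cplx R))%classic ->
  ((fun n => \sum_(i < n) gauss_term A B z i
    - gauss_ratio A B z N * \sum_(i < n) gauss_term A B (z * q ^+ N) i)
   @ \oo --> (0 : cplx R))%classic.
Proof.
elim: N z => [|N IH] z hC hz ht.
  rewrite /gauss_ratio !qpoch_nat0 !mulr1 divr1.
  by under eq_fun do rewrite mul1r subrr; exact: cvg_cst.
have z0 : 1 - z != 0 by have := hz 1%N; rewrite qpoch_natSl qpoch_nat0 mulr1.
have C0 : 1 - z * A * B != 0 by have := hC 1%N; rewrite qpoch_natSl qpoch_nat0 mulr1.
have zqE : z * q * A * B = z * A * B * q by ring.
have hCq n : qpoch_nat (z * q * A * B) q n != 0.
  by have := hC n.+1; rewrite zqE qpoch_natSl mulf_eq0 => /norP[].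
have hzq n : qpoch_nat (z * q) q n != 0.
  by have := hz n.+1; rewrite qpoch_natSl mulf_eq0 => /norP[].
have /(IH _ hCq hzq) {}IH := cvg_gauss_term_shift hC ht.
pose rho := (1 - z * A) * (1 - z * B) / ((1 - z * A * B) * (1 - z)).
have ratioE : gauss_ratio A B z N.+1 = rho * gauss_ratio A B (z * q) N.
  rewrite /gauss_ratio !qpoch_natSl zqE -(mulrAC z A q) -(mulrAC z B q).
  have := hCq N; rewrite zqE => h1; have h2 := hzq N.
  by rewrite /rho; field; rewrite h1 h2 z0 C0.
have stepE n : \sum_(i < n) gauss_term A B z i =
    rho * \sum_(i < n) gauss_term A B (z * q) i
    - (1 - z)^-1 * ((1 - q ^+ n) * gauss_term A B z n).
  have := gauss_sum_contiguous n hC.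
  move: (\sum_(i < n) _) (\sum_(i < n) _) (gauss_term _ _ _ _) => s s' t.
  move/eqP; rewrite subr_eq => /eqP h.
  apply: (mulfI (mulf_neq0 C0 z0)); rewrite h /rho; field.
  by rewrite z0 C0.
have hq1 : ((fun n => (1 - q ^+ n) * gauss_term A B z n) @ \oo --> (0 : cplx R))%classic.
  move/cvgn_nmP: ht => ht; apply/cvgn_nmP => e e0.
  have e20 : 0 < e / 2 by rewrite divr_gt0.
  have [M hM] := ht _ e20; exists M => n /hM; rewrite !subr0 (nmM (1 - _)) => h.
  have : nm (1 - q ^+ n) <= 2.
    apply: le_trans (nmB _ _) _; rewrite nm1 nmX.
    have : nm q ^+ n <= 1 by rewrite exprn_ile1 ?nm_ge0 ?ltW.
    lra.
  move/(ler_wpM2r (nm_ge0 (gauss_term A B z n))) => h'; apply: le_lt_trans h' _; lra.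
pose f n := rho * (\sum_(i < n) gauss_term A B (z * q) i -
      gauss_ratio A B (z * q) N * \sum_(i < n) gauss_term A B (z * q * q ^+ N) i)
    - (1 - z)^-1 * ((1 - q ^+ n) * gauss_term A B z n).
have fE : (fun n => \sum_(i < n) gauss_term A B z i - gauss_ratio A B z N.+1 *
    \sum_(i < n) gauss_term A B (z * q ^+ N.+1) i) = f.
  by apply/funext => n; rewrite [in LHS]stepE ratioE exprS mulrA /f; ring.
rewrite fE (_ : 0 = rho * 0 - (1 - z)^-1 * 0); last by rewrite !mulr0 subr0.
by apply: cvgB; apply: cvgMr.
Qed.

(** For large [N] the argument [z q^N] is small and only the initial term 1 matters. Uniformity in
    [n] allows [N] to be fixed before [n] grows. *)
Lemma gauss_sum_tail A B z (d : R) : (forall n, qpoch_nat (z * A * B) q n != 0) ->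
  0 < d -> exists N0, forall N n, (N0 <= N)%N ->
  nm (\sum_(i < n.+1) gauss_term A B (z * q ^+ N) i - 1) < d.
Proof.
move=> hC d0.
have [K1 K10 hK1] := qpoch_nat_bounded q1 A.
have [K2 K20 hK2] := qpoch_nat_bounded q1 B.
have [K3 K30 hK3] := qpoch_nat_bounded q1 (z * A * B).
have [K4 K40 hK4] := qpoch_nat_inv_bounded q1 hC.
have [K5 K50 hK5] := qpoch_nat_inv_bounded q1 qpoch_nat_qq_neq0.
(* [K3 * K4] bounds [1/(C q^N;q)_r = (C;q)_N / (C;q)_{N+r}] for all [N] and [r]; [K5] bounds
   [1/(q;q)_r]. *)
pose K := K1 * K2 * (K3 * K4 * K5).
have K0 : 0 < K by rewrite !mulr_gt0.
(* [w < 1/2] bounds the terms by a geometric series of sum at most 2, and [w < d / (2 K)] brings the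
   total below [d]. *)
have e0 : 0 < Num.min (2^-1) (d / (K * 2)).
  by rewrite lt_min divr_gt0 ?mulr_gt0 // invr_gt0 ltr0n.
have q01 : 0 <= nm q < 1 by rewrite nm_ge0.
have [N0 hN0] := exprn_small q01 (nm_ge0 z) e0.
exists N0 => N n hN; pose w := nm (z * q ^+ N).
have : w < Num.min (2^-1) (d / (K * 2)).
  apply: le_lt_trans hN0; rewrite /w nmM nmX ler_wpM2l ?nm_ge0 //.
  by rewrite ler_wiXn2l ?nm_ge0 // ltW.
rewrite lt_min ltr_pdivlMr ?mulr_gt0 // => /andP[w2 wd].
have w0 : 0 <= w by exact: nm_ge0.
rewrite big_ord_recl gauss_term0 addrC addKr.
have term_le i : nm (gauss_term A B (z * q ^+ N) i.+1) <= K * (w * (2^-1) ^+ i).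
  rewrite /gauss_term !nmM nmX -/w; apply: ler_pM; rewrite ?mulr_ge0 ?nm_ge0 ?exprn_ge0 //.
    rewrite /K !ler_pM ?mulr_ge0 ?nm_ge0 // invfM nmM ler_pM ?nm_ge0 //.
    have -> : z * q ^+ N * A * B = z * A * B * q ^+ N by ring.
    have -> : qpoch_nat (z * A * B * q ^+ N) q i.+1 =
        qpoch_nat (z * A * B) q (N + i.+1) / qpoch_nat (z * A * B) q N.
      by rewrite qpoch_natD [RHS]mulrC mulKf.
    by rewrite invfM invrK mulrC nmM ler_pM ?nm_ge0.
  by rewrite exprS ler_wpM2l // lerXn2r ?nnegrE ?invr_ge0 // ltW.
apply: le_lt_trans (nm_sum _ _ _) _.
have /le_lt_trans : \sum_(i < n) nm (gauss_term A B (z * q ^+ N) (lift ord0 i)) <=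
    \sum_(i < n) K * (w * (2^-1) ^+ i) by apply: ler_sum => i _; exact: term_le.
apply; rewrite -mulr_sumr -mulr_sumr.
apply: le_lt_trans wd; rewrite [leRHS]mulrCA !ler_wpM2l // ?(ltW K0) //.
have -> : \sum_(i < n) (2^-1 : R) ^+ i = 2 - 2 * (2^-1) ^+ n.
  elim: n => [|n IH]; first by rewrite big_ord0 expr0 mulr1 subrr.
  by rewrite big_ord_recr /= IH exprS mulrA divff // mul1r; ring.
by rewrite gerBl mulr_ge0 // exprn_ge0 // invr_ge0.
Qed.

Lemma gauss_sum A B z : (forall n, qpoch_nat (z * A * B) q n != 0) ->
  (forall n, qpoch_nat z q n != 0) ->
  (gauss_term A B z @ \oo --> (0 : cplx R))%classic ->
  ((fun n => \sum_(i < n) gauss_term A B z i) @ \oo -->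
   qpoch_inf (z * A) q * qpoch_inf (z * B) q
   / (qpoch_inf (z * A * B) q * qpoch_inf z q))%classic.
Proof.
move=> hC hz ht; set L := _ / _.
have ratio_cvg : (gauss_ratio A B z @ \oo --> L)%classic.
  apply: cvgM; first by apply: cvgM; exact: cvg_qpoch_inf.
  by apply: cvgV; [rewrite mulf_neq0 ?qpoch_inf_neq0|apply: cvgM; exact: cvg_qpoch_inf].
apply/cvgn_nmP => e e0; have e30 : 0 < e / 3 by rewrite divr_gt0.
(* [M] will bound the ratio [p], whose product with the tail error then costs at most [e / 3]. *)
pose M := nm L + e / 3.
have M0 : 0 < M by rewrite ltr_wpDl ?nm_ge0.
have [N1 hN1] := gauss_sum_tail hC (divr_gt0 e30 M0).
move/cvgn_nmP: ratio_cvg => /(_ _ e30)[N2 hN2].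
pose N := maxn N1 N2.
have /cvgn_nmP/(_ _ e30)[N3 hN3] := gauss_sum_iter N hC hz ht.
(* The successor makes the sum nonempty, so that it contains the term 1. *)
exists N3.+1 => -[//|n] /ltnW /hN3; rewrite subr0.
have := hN1 N n (leq_maxl _ _); have := hN2 N (leq_maxr _ _).
move: (\sum_(_ < _) _) (\sum_(_ < _) _) (gauss_ratio _ _ _ _) => s s' p h1 h2 h3.
have -> : s - L = (s - p * s') + (p * (s' - 1) + (p - L)) by ring.
apply: le_lt_trans (nmD _ _) _.
have := nmD (p * (s' - 1)) (p - L); rewrite nmM.
have pM : nm p <= M.
  by have := nmD (p - L) L; rewrite subrK /M; lra.
have : nm p * nm (s' - 1) <= M * (e / 3 / M).
  by rewrite ler_pM ?nm_ge0 // ltW.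
by rewrite mulrCA divff ?gt_eqF // mulr1; lra.
Qed.

End Gauss.

(** * Unordered sums *)

Section UnorderedSums.
Variable R : realType.
Local Open Scope fset_scope.
Local Existing Instance totally_filter.

Definition has_sum (I : choiceType) (x : I -> cplx R) (S : cplx R) : Prop :=
  (partial_sum x @ totally --> S)%classic.

Lemma has_sumP (I : choiceType) (x : I -> cplx R) S : has_sum x S <->
  forall e : R, 0 < e -> exists A : {fset I}, forall B : {fset I}, A `<=` B ->
    nm (\sum_(i <- B) x i - S) < e.
Proof.
have psE B : partial_sum x B = \sum_(i <- B) x i.
  by rewrite /partial_sum big_seq_fsetE.
split=> [/cvg_nmP h e /h[A _ hA]|h]; first by exists A => B /hA /=; rewrite psE.
by apply/cvg_nmP => e /h[A hA]; exists A => // B /hA /=; rewrite psE.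
Qed.

Lemma sum_fset_uniq (I : choiceType) (x : I -> cplx R) (s : seq I) : uniq s ->
  \sum_(i <- [fset i in s]) x i = \sum_(i <- s) x i.
Proof.
move=> us; apply: perm_big; apply: uniq_perm => // i.
by rewrite in_fset.
Qed.

(** Adding one index outside a large finite set [A] hardly changes the sum. The left inverse [g]
    makes [e] injective, so [e n] leaves [A] eventually. *)
Lemma has_sum_cvg0 (I : choiceType) (x : I -> cplx R) S (e : nat -> I) (g : I -> nat) :
  cancel e g -> has_sum x S -> ((fun n => x (e n)) @ \oo --> (0 : cplx R))%classic.
Proof.
move=> eg /has_sumP h; apply/cvgn_nmP => d d0.
have [A hA] := h _ (divr_gt0 d0 (ltr0n R 2)).
exists (\max_(i <- A) (g i).+1)%N => n hn; rewrite subr0.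
have nA : e n \notin A.
  apply/negP => enA; have := leq_bigmax_seq (P := predT) (F := fun i => (g i).+1) _ enA isT.
  by rewrite eg => /leq_trans/(_ hn); rewrite ltnn.
have := hA _ (fsubsetU1 (e n) A); have := hA _ (fsubset_refl A).
rewrite big_fsetU1 //= => h1 h2.
rewrite (_ : x (e n) = (x (e n) + \sum_(i <- A) x i - S) - (\sum_(i <- A) x i - S)).
  by apply: le_lt_trans (nmB _ _) _; lra.
by ring.
Qed.

Lemma has_sum_uniq (I : choiceType) (x : I -> cplx R) S S' :
  has_sum x S -> has_sum x S' -> S = S'.
Proof.
move=> /has_sumP h /has_sumP h'; apply/eqP; rewrite -subr_eq0 -nm_eq0.
rewrite eq_le nm_ge0 andbT; apply/ler_addgt0Pl => e e0; rewrite addr0.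
have e20 : 0 < e / 2 by rewrite divr_gt0.
have [A hA] := h _ e20; have [A' hA'] := h' _ e20.
have := hA _ (fsubsetUl A A'); have := hA' _ (fsubsetUr A A').
rewrite (nmC _ S); move: (\sum_(i <- _) _) => t.
by have := nm_triangle t S S'; rewrite (nmC S t); lra.
Qed.

Lemma has_sum0 (I : choiceType) : has_sum (fun _ : I => 0 : cplx R) 0.
Proof.
apply/has_sumP => e e0; exists fset0 => B _.
by rewrite big1 // subrr nm0.
Qed.

Lemma has_sumMl_inv (I : choiceType) (x : I -> cplx R) c S : c != 0 ->
  has_sum (fun i => c * x i) S -> has_sum x (c^-1 * S).
Proof.
move=> c0 /has_sumP h; apply/has_sumP => e e0.
have c0' : 0 < nm c by rewrite nm_gt0.
have [A hA] := h _ (mulr_gt0 e0 c0'); exists A => B /hA.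
rewrite -mulr_sumr => hB.
rewrite -[\sum_(i <- B) x i](mulKf c0) -mulrBr nmM nmV mulrC.
by rewrite ltr_pdivrMr.
Qed.

(* Summation by fibres: (f, g) identifies I with J * nat, and the sum over each
   fibre is only required to exist as a limit of partial sums. *)
Lemma has_sum_fibres (I J : choiceType) (x : I -> cplx R) (y : J -> cplx R) S
    (f : I -> J) (g : I -> nat) (e : J -> nat -> I) :
  (forall j n, f (e j n) = j) -> (forall j n, g (e j n) = n) ->
  (forall i, e (f i) (g i) = i) ->
  (forall j, ((fun n => \sum_(k < n) x (e j k)) @ \oo --> y j)%classic) ->
  has_sum x S -> has_sum y S.
Proof.
move=> fe ge eK hy /has_sumP hx; apply/has_sumP => d d0.
have d20 : 0 < d / 2 by rewrite divr_gt0.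
have [A hA] := hx _ d20; exists [fset f i | i in A] => J1 hJ1.
(* [J1] is finite, so its fibre sums converge jointly. *)
have /cvgn_nmP/(_ _ d20)[N hN] :
    ((fun n => \sum_(j <- J1) \sum_(k < n) x (e j k)) @ \oo --> \sum_(j <- J1) y j)%classic.
  by apply: cvg_big => [|j _]; [exact: add_continuous|exact: hy].
(* The rectangle of the fibres over [J1] cut at [n] contains [A], and its sum is close both to [S]
   and to the sum of [y] over [J1]. *)
pose n := maxn N (\max_(i <- A) (g i).+1)%N.
pose s := [seq e j k | j <- J1, k <- iota 0 n].
have us : uniq s.
  apply: allpairs_uniq => [||[j k] [j' k'] _ _ /= h]; [exact: fset_uniq|exact: iota_uniq|].
  by rewrite -(fe j k) -[k in (_, k)](ge j k) h fe ge.
have /hA : A `<=` [fset i in s].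
  apply/fsubsetP => i iA; rewrite in_fset; apply/allpairsP; exists (f i, g i) => /=.
  split; last by rewrite eK.
    by apply: (fsubsetP hJ1); apply: in_imfset.
  rewrite mem_iota /= add0n leq_max; apply/orP; right.
  exact: (leq_bigmax_seq (P := predT) (F := fun i => (g i).+1) _ iA isT).
rewrite sum_fset_uniq // /s big_allpairs_dep /=.
have := hN n (leq_maxl _ _).
have -> : \sum_(j <- J1) \sum_(k < n) x (e j k) =
    \sum_(j <- J1) \sum_(k <- iota 0 n) x (e j k).
  by apply: eq_bigr => j _; rewrite -(big_mkord predT (x \o e j)) /index_iota subn0.
rewrite nmC; move: (\sum_(j <- J1) \sum_(k <- _) _) => t h1 h2.
by apply: le_lt_trans (nm_triangle t _ _) _; lra.
Qed.

(** The two halves of the integers are fibres over [bool], and [bilateral_cvg] supplies the fibre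
    limits. *)
Lemma has_sum_bilateral (g : int -> cplx R) S :
  bilateral_cvg g -> has_sum g S -> S = bilateral_sum g.
Proof.
move=> [gP gN] hg.
pose e (b : bool) n := if b then Posz n else Negz n.
pose y b : cplx R := if b then limn (series (fun n => g (Posz n)))
  else limn (series (fun n => g (Negz n))).
have /has_sumP hy : has_sum y S.
  apply: (has_sum_fibres (f := fun i : int => if i is Posz _ then true else false)
    (g := fun i : int => match i with Posz n => n | Negz n => n end) (e := e)) hg.
  - by case.
  - by case.
  - by case.
  have seriesE (u : nat -> cplx R) : (fun n => \sum_(k < n) u k) = series u.
    by apply/funext => n; rewrite /series /= big_mkord.
  case; [have := seriesE (fun n => g (Posz n))|have := seriesE (fun n => g (Negz n))].
    by rewrite /e /y => ->; exact: gP.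
  by rewrite /e /y => ->; exact: gN.
have yE : has_sum y (y true + y false).
  apply/has_sumP => d d0; exists [fset true; false] => B hB.
  have -> : B = [fset true; false].
    by apply/eqP; rewrite eqEfsubset hB andbT; apply/fsubsetP => -[]; rewrite !inE.
  by rewrite big_fsetU1 ?inE //= big_seq_fset1 subrr nm0.
by apply: has_sum_uniq yE; apply/has_sumP.
Qed.

End UnorderedSums.

(** * Summing one factor over its larger index *)

Section Factor.
Variables (R : realType) (q : cplx R).
Hypotheses (q1 : nm q < 1) (q0 : q != 0).
Implicit Types (a b c : cplx R).

(* The summand uses (a_j, b_j, c_j) for j < k, and (a, a, q) for the last factor. *)
Definition bailey_factor a b c (M N : int) : cplx R :=
  (qpoch a q M * qpoch (c / b) q N * qpoch b q (M - N))
  / (qpoch c q M * qpoch a q N * qpoch q q (M - N))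
  * (c / (a * b)) ^ (M - N).

Definition bailey_const a b c : cplx R :=
  (qpoch_inf (c / a) q * qpoch_inf (c / b) q)
  / (qpoch_inf c q * qpoch_inf (c / (a * b)) q).

Lemma cvg_gauss_sum_scaled (u : nat -> cplx R) (A B z K : cplx R) : K != 0 ->
  (forall r, u r = K * gauss_term q A B z r) ->
  (forall n, qpoch_nat (z * A * B) q n != 0) -> (forall n, qpoch_nat z q n != 0) ->
  (u @ \oo --> (0 : cplx R))%classic ->
  ((fun n => \sum_(r < n) u r) @ \oo --> K *
   (qpoch_inf (z * A) q * qpoch_inf (z * B) q
    / (qpoch_inf (z * A * B) q * qpoch_inf z q)))%classic.
Proof.
move=> K0 uE hC hz hu; have -> : (fun n => \sum_(r < n) u r) =
    (fun n => K * \sum_(r < n) gauss_term q A B z r).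
  by apply/funext => n; rewrite mulr_sumr; apply: eq_bigr.
apply: cvgMr; apply: gauss_sum => //.
have -> : gauss_term q A B z = (fun r => K^-1 * u r).
  by apply/funext => r; rewrite uE mulKf.
by rewrite -[0](mulr0 K^-1); apply: cvgMr.
Qed.

(** With [M = n + r] the factor is a multiple of the Gauss term with parameters [a q^n], [b],
    [c q^n]; the argument [z = c/(ab)] does not depend on [n]. *)
Lemma bailey_factor_sum a b c (n : nat) : a != 0 -> b != 0 ->
  (forall n, qpoch_nat a q n != 0) -> (forall n, qpoch_nat c q n != 0) ->
  (forall n, qpoch_nat (c / (a * b)) q n != 0) ->
  ((fun r => bailey_factor a b c (Posz (n + r)) (Posz n)) @ \oo --> (0 : cplx R))%classic ->
  ((fun m => \sum_(r < m) bailey_factor a b c (Posz (n + r)) (Posz n)) @ \oo -->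
   bailey_const a b c)%classic.
Proof.
move=> a0 b0 ha hc hz hu; set z := c / (a * b) in hz.
pose K := qpoch_nat (c / b) q n / qpoch_nat c q n.
have uE r : bailey_factor a b c (Posz (n + r)) (Posz n) =
    K * gauss_term q (a * q ^+ n) b z r.
  rewrite /bailey_factor (_ : Posz (n + r) - Posz n = Posz r); last by lia.
  rewrite /= !qpoch_natD /gauss_term /K.
  rewrite (_ : z * (a * q ^+ n) * b = c * q ^+ n); last first.
    by rewrite /z; field; rewrite a0 b0.
  rewrite -[_ ^ _]/(_ ^+ r) -/z !invfM.
  (* [(a;q)_n] occurs above and below on the left; the same quotient is inserted on the right for
     [ring]. *)
  by rewrite -[RHS]mul1r -(divff (ha n)); ring.
(* If [K = 0], nothing follows about the Gauss terms, but the factor and the constant both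
   vanish. *)
have [cb0|cb0] := eqVneq (qpoch_nat (c / b) q n) 0.
  have -> : bailey_const a b c = 0.
    by rewrite /bailey_const (qpoch_inf_shift q1 (c / b) n) cb0 !(mul0r, mulr0).
  have -> : (fun m => \sum_(r < m) bailey_factor a b c (Posz (n + r)) (Posz n)) =
      fun=> 0.
    by apply/funext => m; rewrite big1 // => r _; rewrite uE /K cb0 !mul0r.
  exact: cvg_cst.
have zE : z * (a * q ^+ n) * b = c * q ^+ n by rewrite /z; field; rewrite a0 b0.
have hcq m : qpoch_nat (z * (a * q ^+ n) * b) q m != 0.
  by rewrite zE; have := hc (n + m)%N; rewrite qpoch_natD mulf_eq0 => /norP[].
have K0 : K != 0 by rewrite /K mulf_neq0 ?invr_eq0.
have := cvg_gauss_sum_scaled K0 uE hcq hz hu.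
suff -> : bailey_const a b c = K * (qpoch_inf (z * (a * q ^+ n)) q * qpoch_inf (z * b) q /
    (qpoch_inf (z * (a * q ^+ n) * b) q * qpoch_inf z q)) by [].
rewrite /bailey_const (qpoch_inf_shift q1 (c / b) n) (qpoch_inf_shift q1 c n) zE -/z.
have -> : z * (a * q ^+ n) = c / b * q ^+ n by rewrite /z; field; rewrite a0 b0.
have -> : z * b = c / a by rewrite /z; field; rewrite a0 b0.
rewrite /K !invfM; ring.
Qed.

(** Reversing the factors gives [(a q^-n;q)_n = (-a)^n q^(-n(n+1)/2) (q/a;q)_n]; in the quotient
    with the same formula for [q/a] the quadratic power of [q] cancels. *)
Lemma qpoch_nat_reflection a n : a != 0 ->
  qpoch_nat (a * q ^- n) q n * qpoch_nat a q n * (q / (a * a)) ^+ n =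
  qpoch_nat (q / a * q ^- n) q n * qpoch_nat (q / a) q n.
Proof.
move=> a0; elim: n => [|n IH]; first by rewrite !qpoch_nat0 !mulr1.
have shift x : x * q ^- n.+1 * q = x * q ^- n.
  by rewrite exprSr invfM -!mulrA mulVf // mulr1.
rewrite (qpoch_natSl _ (a * _)) (qpoch_natSl _ (q / a * _)) !shift !qpoch_natS.
rewrite (exprSr (q / (a * a))); have qn0 : q ^+ n != 0 by rewrite expf_neq0.
transitivity ((1 - a * q ^- n.+1) * (1 - a * q ^+ n) * (q / (a * a)) *
  (qpoch_nat (a * q ^- n) q n * qpoch_nat a q n * (q / (a * a)) ^+ n)); first by ring.
rewrite IH exprSr; field.
by rewrite q0 a0 qn0.
Qed.

(** For [N < 0] the sum starts at [M = 0]. As [b = a] and [c = q], the pairs [(a)_M/(q)_M] and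
    [(a)_{M-N}/(q)_{M-N}] have the same shape, so this is again a Gauss sum, with parameters [a],
    [a q^-N], [q q^-N]. *)
Lemma bailey_factor_sum_bilateral a (N : int) : a != 0 ->
  (forall n, qpoch_nat a q n != 0) -> qpoch_neg_defined a q ->
  qpoch_neg_defined (q / a) q -> (forall n, qpoch_nat (q / (a * a)) q n != 0) ->
  let M r := Posz ((if N is Posz n then n else 0) + r) in
  ((fun r => bailey_factor a a q (M r) N) @ \oo --> (0 : cplx R))%classic ->
  ((fun m => \sum_(r < m) bailey_factor a a q (M r) N) @ \oo -->
   bailey_const a a q)%classic.
Proof.
move=> a0 ha haN hqaN hz M; rewrite {}/M.
case: N => n; first by apply: bailey_factor_sum => // m; exact: qpoch_nat_qq_neq0.
move=> hu; set z := q / (a * a) in hz.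
have refl := qpoch_nat_reflection n.+1 a0; rewrite -/z in refl.
have zn0 : z ^+ n.+1 != 0 by rewrite expf_neq0 // mulf_neq0 // invr_eq0 mulf_neq0.
(* [hqaN] concerns shifted products only; this one is nonzero because the left side of the
   reflection is. *)
have qa0 : qpoch_nat (q / a) q n.+1 != 0.
  apply: contra_neq (mulf_neq0 (mulf_neq0 (haN n.+1) (ha n.+1)) zn0).
  by rewrite refl => ->; rewrite mulr0.
have qq0 := qpoch_nat_qq_neq0 q1 n.+1.
(* The first quotient is [(q/a;q)_N / (a;q)_N] at [N = -(n+1)], turned over by the convention for
   negative indices. *)
pose K := qpoch_nat (a * q ^- n.+1) q n.+1 / qpoch_nat (q / a * q ^- n.+1) q n.+1
  * (qpoch_nat a q n.+1 / qpoch_nat q q n.+1) * z ^+ n.+1.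
have K0 : K != 0 by rewrite !mulf_neq0 ?invr_eq0.
have zE : z * a * (a * q ^+ n.+1) = q * q ^+ n.+1 by rewrite /z; field.
have uE r : bailey_factor a a q (Posz (0 + r)) (Negz n) =
    K * gauss_term q a (a * q ^+ n.+1) z r.
  rewrite /bailey_factor add0n (_ : Posz r - Negz n = Posz (n.+1 + r)); last by lia.
  rewrite /= !qpoch_natD /gauss_term /K zE -[_ ^ _]/(_ ^+ (n.+1 + r)) -/z exprD.
  by rewrite !invfM !invrK; ring.
have hC m : qpoch_nat (z * a * (a * q ^+ n.+1)) q m != 0.
  rewrite zE; have := qpoch_nat_qq_neq0 q1 (n.+1 + m).
  by rewrite qpoch_natD mulf_eq0 => /norP[].
have := cvg_gauss_sum_scaled K0 uE hC hz hu.
suff -> : bailey_const a a q = K * (qpoch_inf (z * a) q * qpoch_inf (z * (a * q ^+ n.+1)) q /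
    (qpoch_inf (z * a * (a * q ^+ n.+1)) q * qpoch_inf z q)) by [].
rewrite zE (mulrA z a) (_ : z * a = q / a); last by rewrite /z; field.
have -> : K = qpoch_nat (q / a) q n.+1 / qpoch_nat q q n.+1.
  have -> : K = (qpoch_nat (a * q ^- n.+1) q n.+1 * qpoch_nat a q n.+1 * z ^+ n.+1)
    / qpoch_nat (q / a * q ^- n.+1) q n.+1 / qpoch_nat q q n.+1 by rewrite /K; ring.
  by rewrite refl [_ * qpoch_nat (q / a) q n.+1]mulrC mulfK.
rewrite /bailey_const -/z [in LHS](qpoch_inf_shift q1 q n.+1).
(* Only one of the two equal factors is split; the other stands whole on the right. *)
rewrite {2}(qpoch_inf_shift q1 (q / a) n.+1) !invfM. ring.
Qed.

End Factor.

(** * Coordinates on the multi-indices, one variable at a time *)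

Section MultiIndex.

Lemma admissible_cons k x (t : k.+2.-tuple int) :
  admissible [tuple of x :: t] = (t`_0 <= x) && admissible t.
Proof.
rewrite /admissible /= andbA; congr (_ && _).
apply/forallP/andP => [h|[h0 /forallP h] i]; last first.
  by case: (unliftP ord0 i) => [j|] ->; rewrite ?lift0 //; exact: (h j).
split; first exact: (h ord0).
by apply/forallP => j; have := h (lift ord0 j); rewrite lift0.
Qed.

Lemma admissible_pair (x y : int) : admissible [tuple x; y] = (y <= x) && (0 <= x).
Proof.
rewrite /admissible /=; congr (_ && _).
by apply/forallP/idP => [/(_ ord0)|h [[|//] i]].
Qed.

(** This confines every factor but the last to natural indices, where [bailey_factor_sum]
    applies. *)
Lemma admissible_head_ge0 k (m : k.+2.-tuple int) : admissible m -> 0 <= m`_0.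
Proof.
elim: k m => [|k IH] m; first by move=> /andP[].
case/tupleP: m => x t; rewrite admissible_cons => /andP[tx /IH t0].
exact: le_trans t0 tx.
Qed.

(** The least [m_k] allowed above [m_{k+1} = N]. *)
Definition pos_part (N : int) : nat := if N is Posz n then n else 0.

Fact mi_pair_subproof N r : admissible [tuple Posz (pos_part N + r); N].
Proof. by rewrite admissible_pair; case: N => n /=; lia. Qed.

Definition mi_pair N r : multi_index 1 :=
  exist _ [tuple Posz (pos_part N + r); N] (mi_pair_subproof N r).

Definition mi_snd (i : multi_index 1) : int := (val i)`_1.

Definition mi_excess (i : multi_index 1) : nat :=
  absz ((val i)`_0 - Posz (pos_part (val i)`_1))%R.

Lemma mi_pairK i : mi_pair (mi_snd i) (mi_excess i) = i.
Proof.
apply/val_inj/val_inj; case: i => m; case/tupleP: m => x m; case/tupleP: m => y m.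
rewrite (tuple0 m) /mi_snd /mi_excess /=.
move=> /andP[/forallP/(_ ord0) /= yx x0]; congr [:: _; _].
by case: y yx => n /=; lia.
Qed.

Fact mi_cons_subproof k (j : multi_index k.+1) (r : nat) :
  admissible [tuple of ((val j)`_0 + Posz r) :: val j].
Proof. by rewrite admissible_cons (valP j) andbT lerDl. Qed.

(** The new head is given by its gap to the next entry, so each fibre of [mi_tail] is a copy of
    [nat]. *)
Definition mi_cons k (j : multi_index k.+1) r : multi_index k.+2 :=
  exist _ [tuple of ((val j)`_0 + Posz r) :: val j] (mi_cons_subproof j r).

Fact mi_tail_subproof k (i : multi_index k.+2) :
  admissible [tuple of behead (val i)].
Proof.
case: i => m /=; case/tupleP: m => x t.
by rewrite admissible_cons => /andP[_]; congr (admissible _); exact: val_inj.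
Qed.

Definition mi_tail k (i : multi_index k.+2) : multi_index k.+1 :=
  exist _ [tuple of behead (val i)] (mi_tail_subproof i).

Definition mi_gap k (i : multi_index k.+2) : nat := absz ((val i)`_0 - (val i)`_1)%R.

Lemma mi_consK k (i : multi_index k.+2) : mi_cons (mi_tail i) (mi_gap i) = i.
Proof.
apply/val_inj/val_inj; case: i => m /=; case/tupleP: m => x t.
rewrite /mi_gap /= admissible_cons => /andP[tx _].
by congr (_ :: _); rewrite gez0_abs ?subr_ge0 // addrC subrK.
Qed.

Lemma mi_tail_cons k (j : multi_index k.+1) r : mi_tail (mi_cons j r) = j.
Proof. by apply/val_inj/val_inj. Qed.

Lemma mi_gap_cons k (j : multi_index k.+1) r : mi_gap (mi_cons j r) = r.
Proof. by rewrite /mi_gap /=; lia. Qed.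

End MultiIndex.

(** * Stripping the factors from the multiple series *)

Section Main.
Variables (R : realType) (q a : cplx R) (g : int -> cplx R).
Hypotheses (q1 : nm q < 1) (q0 : q != 0) (a0 : a != 0).
Hypotheses (ha : forall n, qpoch_nat a q n != 0) (haN : qpoch_neg_defined a q).
Hypothesis (hqaN : qpoch_neg_defined (q / a) q).
Hypothesis (hz : forall n, qpoch_nat (q / (a * a)) q n != 0).
Hypothesis (hG : bilateral_cvg g).

Lemma multi_term_pair (a_ b_ c_ : 'I_0 -> cplx R) N r :
  multi_term (k := 1) q a_ b_ c_ a g (mi_pair N r) =
  bailey_factor q a a q (Posz (pos_part N + r)) N * g N.
Proof. by rewrite /multi_term big_ord0 mul1r expr2. Qed.

Lemma multi_term_cons k (a_ b_ c_ : 'I_k.+1 -> cplx R) j r :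
  multi_term (k := k.+2) q a_ b_ c_ a g (mi_cons j r) =
  bailey_factor q (a_ ord0) (b_ ord0) (c_ ord0) ((val j)`_0 + Posz r) (val j)`_0 *
  multi_term (k := k.+1) q (a_ \o lift ord0) (b_ \o lift ord0) (c_ \o lift ord0) a g j.
Proof. by rewrite /multi_term big_ord_recl !mulrA. Qed.

(** [s] is the rest of the summand, constant on a fibre. If [s = 0], nothing is known about [u], but
    the fibre sum is 0 anyway. *)
Lemma cvg_factor_sum (u : nat -> cplx R) (L s : cplx R) :
  ((u @ \oo --> (0 : cplx R))%classic ->
    ((fun n => \sum_(r < n) u r) @ \oo --> L)%classic) ->
  ((fun r => u r * s) @ \oo --> (0 : cplx R))%classic ->
  ((fun n => \sum_(r < n) u r * s) @ \oo --> L * s)%classic.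
Proof.
move=> hu hus; under eq_fun do rewrite -mulr_suml.
have [->|s0] := eqVneq s 0.
  by under eq_fun do rewrite mulr0; rewrite mulr0; exact: cvg_cst.
apply: cvgMl; apply: hu.
have -> : u = (fun r => u r * s * s^-1) by apply/funext => r; rewrite mulfK.
by rewrite -[0](mul0r s^-1); apply: cvgMl.
Qed.

(** A vanishing constant [c] gives no information on [x], so this case is settled by [S = 0]. *)
Lemma has_sum_scaled (I : choiceType) (x : I -> cplx R) c S T :
  (has_sum x (c^-1 * S) -> c^-1 * S = T) -> has_sum (fun i => c * x i) S -> S = c * T.
Proof.
have [-> _|c0 h /(has_sumMl_inv c0)/h <-] := eqVneq c 0; last by rewrite mulVKf.
rewrite mul0r => h; apply: has_sum_uniq h _.
by under eq_fun do rewrite mul0r; exact: has_sum0.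
Qed.

(** Induction on [k], removing the outermost variable. [S] is any unordered sum, so summability
    passes to the shorter series through the fibres. *)
Lemma multi_sum k (a_ b_ c_ : 'I_k -> cplx R) S :
  (forall j, a_ j != 0) -> (forall j, b_ j != 0) ->
  (forall j n, qpoch_nat (a_ j) q n != 0) ->
  (forall j n, qpoch_nat (c_ j) q n != 0) ->
  (forall j n, qpoch_nat (c_ j / (a_ j * b_ j)) q n != 0) ->
  has_sum (multi_term (k := k.+1) q a_ b_ c_ a g) S ->
  S = (\prod_(j < k) bailey_const q (a_ j) (b_ j) (c_ j)) *
      (bailey_const q a a q * bilateral_sum g).
Proof.
elim: k a_ b_ c_ S => [|k IH] a_ b_ c_ S ha0 hb0 ha_ hc_ hz_ hS.
  rewrite big_ord0 mul1r; apply: (has_sum_scaled (x := g)); first exact: has_sum_bilateral.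
  have gapK N : cancel (mi_pair N) mi_excess by move=> r; rewrite /mi_excess /=; lia.
  apply: (has_sum_fibres (f := mi_snd) _ gapK mi_pairK _ hS) => [N r|N]; first by [].
  (* Unordered convergence makes the terms tend to 0 along the fibre, as the q-Gauss sum
     requires. *)
  have := has_sum_cvg0 (gapK N) hS.
  under eq_fun do rewrite multi_term_pair.
  under [X in _ -> (X @ _ --> _)%classic]eq_fun do under eq_bigr do rewrite multi_term_pair.
  by apply: cvg_factor_sum; exact: bailey_factor_sum_bilateral.
rewrite big_ord_recl -mulrA; apply: (has_sum_scaled (x := multi_term (k := k.+1) q
    (a_ \o lift ord0) (b_ \o lift ord0) (c_ \o lift ord0) a g)).
  by apply: IH => *; rewrite /=.
apply: (has_sum_fibres (@mi_tail_cons k) (@mi_gap_cons k) (@mi_consK k) _ hS) => j.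
have := has_sum_cvg0 (mi_gap_cons j) hS.
under eq_fun do rewrite multi_term_cons.
under [X in _ -> (X @ _ --> _)%classic]eq_fun do under eq_bigr do rewrite multi_term_cons.
apply: cvg_factor_sum.
have [n ->] : exists n, (val j)`_0 = Posz n.
  by case: ((val j)`_0) (admissible_head_ge0 (valP j)) => // n _; exists n.
exact: bailey_factor_sum.
Qed.

End Main.

Theorem theorem3 (R : realType) (q : cplx R) (k : nat)
    (a_ b_ c_ : 'I_k.-1 -> cplx R) (a : cplx R) (g : int -> cplx R)
    (hq : `|q| < 1) (hk : (1 <= k)%N)
    (* no denominator vanishes *)
    (hq0 : q != 0)
    (ha_0 : forall j, a_ j != 0) (hb_0 : forall j, b_ j != 0) (ha0 : a != 0)
    (ha_ : forall j (n : nat), qpoch_nat (a_ j) q n != 0)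
    (hc_ : forall j (n : nat), qpoch_nat (c_ j) q n != 0)
    (hcab : forall j, qpoch_inf (c_ j / (a_ j * b_ j)) q != 0)
    (ha : forall n : nat, qpoch_nat a q n != 0)
    (haneg : qpoch_neg_defined a q)
    (hqaneg : qpoch_neg_defined (q / a) q)
    (hqa2 : qpoch_inf (q / a ^+ 2) q != 0)
    (* both series converge *)
    (hL : unordered_cvg (multi_term q a_ b_ c_ a g))
    (hG : bilateral_cvg g) :
  summability.sum (multi_term q a_ b_ c_ a g) =
    (qpoch_inf (q / a) q * qpoch_inf (q / a) q)
    / (qpoch_inf q q * qpoch_inf (q / a ^+ 2) q)
    * (\prod_(j < k.-1)
         ((qpoch_inf (c_ j / a_ j) q * qpoch_inf (c_ j / b_ j) q)
          / (qpoch_inf (c_ j) q * qpoch_inf (c_ j / (a_ j * b_ j)) q)))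
    * bilateral_sum g.
Proof.
case: k hk a_ b_ c_ ha_0 hb_0 ha_ hc_ hcab hL => // k _ a_ b_ c_ ha_0 hb_0 ha_ hc_ hcab hL.
have q1 := nm_lt1 hq; rewrite expr2 in hqa2 *.
have hz n := qpoch_nat_neq0 q1 n hqa2.
(* [hL] is by definition convergence to the chosen limit, that is, [has_sum] with this limit as
   [S]. *)
rewrite /summability.sum (multi_sum q1 hq0 ha0 ha haneg hqaneg hz hG ha_0 hb_0 ha_ hc_ _ hL).
  by rewrite /bailey_const; ring.
by move=> j n; exact: qpoch_nat_neq0 (hcab j).
Qed.
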